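(* Let $D$ be an integral domain and let $p$ be a prime element of $D$ such that $\bigcap_{n=1}^\infty p^nD=0$. Let $R$ be a commutative ring with $D\subseteq R$ a (unital) ring extension such that $p$ is a unit of $R$. Then $R$ has a maximal subring $W$ which is integrally closed in $R$, contains $D$, and conches $\frac{1}{p}$ in $R$ (that is, $p\in W$, $\frac{1}{p}\notin W$, and $W$ is maximal among subrings of $R$ containing $p$ and not containing $\frac1p$).
   Context: All rings are commutative with $1\neq 0$ and all subrings and ring extensions are unital. A maximal subring of a ring $R$ is a proper subring of $R$ that is maximal with respect to inclusion among proper subrings of $R$. For a ring $T$ and a unit $x\in T$, a subring $V$ of $T$ is said to conch $x$ in $T$ (or to be an $x$-conch subring) if $x^{-1}\in V$, $x\notin V$, and $V$ is maximal with respect to inclusion among subrings of $T$ containing $x^{-1}$ but not $x$. *)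

(* Defs.v *)
From HB Require Import structures.
From mathcomp Require Import all_boot all_order all_algebra.
Set Implicit Arguments. Unset Strict Implicit. Unset Printing Implicit Defensive.
Import GRing.Theory.
Local Open Scope ring_scope.

Definition is_subring (R : comUnitRingType) (S : R -> Prop) : Prop :=
  [/\ S 1, (forall x y, S x -> S y -> S (x - y)) & (forall x y, S x -> S y -> S (x * y))].

Definition subset_of (R : Type) (S T : R -> Prop) : Prop := forall x, S x -> T x.

Definition maximal_subring (R : comUnitRingType) (W : R -> Prop) : Prop :=
  [/\ is_subring W, (exists x, ~ W x) &
      (forall T, is_subring T -> subset_of W T -> (exists x, ~ T x) -> subset_of T W)].

Definition integral_over (R : comUnitRingType) (S : R -> Prop) (x : R) : Prop :=
  exists q : {poly R}, [/\ q \is monic, (forall i, S q`_i) & root q x].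

Definition integrally_closed_in (R : comUnitRingType) (S : R -> Prop) : Prop :=
  forall x : R, integral_over S x -> S x.

Definition conches (R : comUnitRingType) (V : R -> Prop) (x : R) : Prop :=
  [/\ is_subring V, V x^-1, ~ V x &
      (forall V', is_subring V' -> subset_of V V' -> V' x^-1 -> ~ V' x -> subset_of V' V)].

Definition dvd_in (R : comUnitRingType) (D : R -> Prop) (a b : R) : Prop :=
  exists c, D c /\ b = a * c.

(* D is an integral domain (as a subring of R; 1 <> 0 holds since R is nontrivial) *)
Definition is_domain_subring (R : comUnitRingType) (D : R -> Prop) : Prop :=
  is_subring D /\ (forall a b, D a -> D b -> a * b = 0 -> a = 0 \/ b = 0).

Definition prime_elt_in (R : comUnitRingType) (D : R -> Prop) (p : R) : Prop :=
  [/\ D p, p <> 0, ~ (exists u, D u /\ p * u = 1) &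
      (forall a b, D a -> D b -> dvd_in D p (a * b) -> dvd_in D p a \/ dvd_in D p b)].

(* Main.v *)
(** Starting from [D], let [A] be maximal among the subrings in which [p] is
    prime and [⋂ p^n A = 0], where enlarging [A] to [A'] must respect
    divisibility by [p] ([pA' ∩ A = pA]).  If every [f] in [A[X]] killing [t]
    were divisible by [p], then, by Gauss's lemma, [A[t]] would again be such a
    ring; hence every [t] in [R] is a root of some [f] in [A[X]] outside [pA[X]].
    Inverting [S = A \ pA] would turn [A] into a DVR over which [R] is algebraic.
    To stay inside [R], take instead a subring [W] containing [A] maximal with
    [pW ∩ S = ∅]: a Cayley-Hamilton argument shows that [W] contains the roots
    of polynomials over [W] with leading coefficient in [S], and therefore some
    [p^k t] for every [t].  Thus [W[1/p] = R] and [1/p] is not in [W].  Any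
    subring [V] containing [W] and maximal without [1/p] is then a maximal
    subring, as a larger one contains [W] and [1/p]; the same Cayley-Hamilton
    argument with [S = {1}] shows that it is integrally closed. *)

Require Import Defs.
From HB Require Import structures.
From mathcomp Require Import all_boot all_order all_algebra.
From mathcomp Require Import boolp classical_sets zify.
Import GRing.Theory.
Local Open Scope ring_scope.

(** * Zorn's lemma and unions of chains of subrings *)

(** [ZL_preorder] is applied to the elements above [t0] that satisfy [P]; there [t0] bounds the
    empty chain, so [chainP] only has to treat nonempty ones. *)
Lemma zorn_above (T : Type) (P : T -> Prop) (le : T -> T -> Prop) (t0 : T) :
  (forall t, le t t) ->
  (forall r s t, le r s -> le s t -> le r t) ->
  (forall C : T -> Prop, (exists c, C c) -> (forall c, C c -> P c) ->
     (forall s t, C s -> C t -> le s t \/ le t s) ->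
     exists t, P t /\ forall s, C s -> le s t) ->
  P t0 ->
  exists m, [/\ P m, le t0 m & forall s, P s -> le m s -> le s m].
Proof.
move=> le_refl le_trans chainP Pt0.
pose T' := {t | P t /\ le t0 t}.
pose le' (s t : T') := `[< le (sval s) (sval t) >].
have [] := @ZL_preorder T' (exist _ t0 (conj Pt0 (le_refl t0))) le'.
- by move=> t; apply/asboolP.
- by move=> r s t /asboolP rs /asboolP st; apply/asboolP/le_trans/st.
- move=> C Ctot; have [[c Cc]|C0] := pselect (exists c, C c); last first.
    by exists (exist _ t0 (conj Pt0 (le_refl t0))) => s Cs; case: C0; exists s.
  have [||| t [Pt tmax]] := chainP (fun t => exists2 s, C s & sval s = t).
  + by exists (sval c), c.
  + by move=> _ [s _ <-]; case: (svalP s).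
  + move=> _ _ [s Cs <-] [t Ct <-].
    by have [/asboolP|/asboolP] := Ctot _ _ Cs Ct; [left|right].
  + have t0t : le t0 t.
      apply: le_trans (svalP c).2 _; exact: tmax (ex_intro2 _ _ c Cc erefl).
    exists (exist _ t (conj Pt t0t)) => s Cs.
    by apply/asboolP/tmax; exists s.
- move=> [m [Pm t0m]] mmax; exists m; split=> // s Ps ms.
  have := mmax (exist _ s (conj Ps (le_trans _ _ _ t0m ms))).
  by move=> /(_ (asboolT ms)) /asboolP.
Qed.

Lemma subring_chain (R : comUnitRingType) (C : (R -> Prop) -> Prop) :
  (exists A, C A) -> (forall A, C A -> is_subring A) ->
  (forall A B, C A -> C B -> subset_of A B \/ subset_of B A) ->
  is_subring (fun x => exists2 A, C A & A x).
Proof.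
move=> [A0 CA0] Csub Ctot.
have common x y A B : C A -> A x -> C B -> B y -> exists2 E, C E & E x /\ E y.
  move=> CA Ax CB By; have [sAB|sBA] := Ctot _ _ CA CB.
    by exists B => //; split=> //; apply: sAB.
  by exists A => //; split=> //; apply: sBA.
split.
- by exists A0 => //; case: (Csub _ CA0).
- move=> x y [A CA Ax] [B CB By]; have [E CE [Ex Ey]] := common _ _ _ _ CA Ax CB By.
  by exists E => //; have [_ + _] := Csub _ CE; apply.
- move=> x y [A CA Ax] [B CB By]; have [E CE [Ex Ey]] := common _ _ _ _ CA Ax CB By.
  by exists E => //; have [_ _] := Csub _ CE; apply.
Qed.

(** * Subrings as closed predicates, and the subring [A[t]] *)

(** The proof [hA] is carried in the term so that the closure instance below can be inferred from it
    and the [rpred] lemmas apply. *)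
Definition subring_mem (R : comUnitRingType) (A : R -> Prop) of is_subring A :
  {pred R} := fun x => `[< A x >].

Lemma subring_memP (R : comUnitRingType) (A : R -> Prop) (hA : is_subring A) (x : R) :
  reflect (A x) (x \in subring_mem R A hA).
Proof. exact: asboolP. Qed.

Lemma subring_mem_closed (R : comUnitRingType) (A : R -> Prop) (hA : is_subring A) :
  subring_closed (subring_mem R A hA).
Proof.
split; first by apply/subring_memP; case: hA.
- by move=> x y /subring_memP Ax /subring_memP Ay; apply/subring_memP; case: hA => _ + _; apply.
- by move=> x y /subring_memP Ax /subring_memP Ay; apply/subring_memP; case: hA => _ _; apply.
Qed.

HB.instance Definition _ (R : comUnitRingType) (A : R -> Prop) (hA : is_subring A) :=
  GRing.isSubringClosed.Build R (subring_mem R A hA) (subring_mem_closed R A hA).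

Definition adjoin (R : comUnitRingType) (A : R -> Prop) (hA : is_subring A) (t x : R) : Prop :=
  exists2 q : {poly R}, q \is a polyOver (subring_mem R A hA) & x = q.[t].

Lemma adjoin_subring (R : comUnitRingType) (A : R -> Prop) (hA : is_subring A) (t : R) :
  is_subring (adjoin R A hA t).
Proof.
split.
- by exists 1; rewrite ?rpred1 // hornerC.
- by move=> _ _ [f Af ->] [g Ag ->]; exists (f - g); rewrite ?rpredB // hornerD hornerN.
- by move=> _ _ [f Af ->] [g Ag ->]; exists (f * g); rewrite ?rpredM // hornerM.
Qed.

Lemma sub_adjoin (R : comUnitRingType) (A : R -> Prop) (hA : is_subring A) (t : R) :
  subset_of A (adjoin R A hA t).
Proof.
by move=> x Ax; exists x%:P; rewrite ?hornerC // polyOverC; apply/subring_memP.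
Qed.

Lemma mem_adjoin (R : comUnitRingType) (A : R -> Prop) (hA : is_subring A) (t : R) :
  adjoin R A hA t t.
Proof. by exists 'X; rewrite ?polyOverX // hornerX. Qed.

(** * Pseudo-division, Cayley-Hamilton and integrality *)

(** Each step multiplies by the leading coefficient of [f] and cancels the top term against a
    multiple of [f], which vanishes at [r]. When the division ends early, the remaining factors are
    absorbed into [g]. *)
Lemma pseudo_reduction (R : comUnitRingType) (W : subringClosed R) (r : R) (f h : {poly R}) (m : nat) :
  f \is a polyOver W -> root f r -> h \is a polyOver W -> (size h <= m)%N ->
  exists g : {poly R}, [/\ g \is a polyOver W, (size g <= size f)%N &
    lead_coef f ^+ m * h.[r] = g.[r]].
Proof.
move=> Wf /rootP fr0; elim: m h => [|m IHm] h Wh.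
  by rewrite leqn0 size_poly_eq0 => /eqP->; exists 0; rewrite rpred0 size_poly0 horner0 mulr0.
move=> hm; have [hf|fh] := leqP (size h) (size f).
  exists (lead_coef f ^+ m.+1 *: h); rewrite hornerZ (leq_trans (size_scale_leq _ _)) //.
  by rewrite polyOverZ // rpredX //; apply/polyOverP.
have [d dE] : exists d, size h = (size f + d)%N.
  by exists (size h - size f)%N; rewrite subnKC // ltnW.
pose h' := lead_coef f *: h - lead_coef h *: ('X^d * f).
have Wl (q : {poly R}) : q \is a polyOver W -> lead_coef q \in W.
  by move/polyOverP => Wq; apply: Wq.
have Wh' : h' \is a polyOver W.
  by rewrite rpredB ?polyOverZ ?rpredM ?polyOverXn ?Wl.
have h'm : (size h' <= m)%N.
  apply/leq_sizeP => j mj; rewrite !coefB !coefZ coefXnM.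
  have [hj|hj] := leqP (size h) j.
    have hj' : (size f <= j - d)%N by lia.
    rewrite (nth_default _ hj) (nth_default _ hj') mulr0 ifF ?mulr0 ?subr0 //.
    by lia.
  have -> : j = (size h).-1 by lia.
  (* At this top index [j < d] forces [f = 0]; otherwise the two leading products cancel. *)
  rewrite -lead_coefE; case: ifP => [hlt|_].
    have /eqP : size f = 0%N by lia.
    by rewrite size_poly_eq0 => /eqP->; rewrite lead_coef0 mul0r mulr0 subr0.
  rewrite (_ : (_ - _)%N = (size f).-1); last by lia.
  by rewrite -lead_coefE mulrC subrr.
have [g [Wg gf gE]] := IHm h' Wh' h'm.
exists g; split=> //; rewrite -gE exprSr -mulrA; congr (_ * _).
by rewrite hornerD hornerN !hornerZ hornerM fr0 !mulr0 subr0.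
Qed.

Lemma char_poly_over (R : comUnitRingType) (W : subringClosed R) (n : nat) (M : 'M[R]_n) :
  (forall i j, M i j \in W) -> char_poly M \is a polyOver W.
Proof.
move=> WM; apply: rpred_sum => s _; rewrite rpredM ?rpred_sign //.
apply: rpred_prod => i _; rewrite !mxE rpredB ?rpredMn ?polyOverX ?polyOverC //.
Qed.

(** The adjugate turns [(y - M) v = 0] into [det (y - M) v = 0]. As [R] may have zero divisors, it
    is the coordinate 1 of [v] that makes the determinant vanish. *)
Lemma eigenvector_root_char_poly (R : comUnitRingType) (n : nat) (M : 'M[R]_n.+1) (v : 'cV[R]_n.+1) (y : R) :
  M *m v = y *: v -> v ord0 ord0 = 1 -> root (char_poly M) y.
Proof.
move=> Mv v1; apply/rootP.
have -> : (char_poly M).[y] = \det (y%:M - M).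
  rewrite -[LHS]/(horner_eval y _) -det_map_mx; congr (\det _).
  by apply/matrixP => i j; rewrite !mxE rmorphB rmorphMn /= /horner_eval hornerX hornerC.
have : (\adj (y%:M - M) *m (y%:M - M)) *m v = 0.
  by rewrite -mulmxA mulmxBl Mv mul_scalar_mx subrr mulmx0.
by rewrite mul_adj_mx mul_scalar_mx => /matrixP/(_ ord0 ord0); rewrite !mxE v1 mulr1.
Qed.

(* Multiplication by [lead_coef f ^+ m * h.[r]] maps the powers [r ^+ i],
   [i <= size f], into their span over [W]; apply Cayley-Hamilton. *)
Lemma adjoin_integral (R : comUnitRingType) (W : subringClosed R) (r : R) (f h : {poly R}) :
  f \is a polyOver W -> root f r -> h \is a polyOver W ->
  exists m, exists g : {poly R},
    [/\ g \is monic, g \is a polyOver W & root g (lead_coef f ^+ m * h.[r])].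
Proof.
(* This [m] serves all [h * 'X^i] with [i <= n] at once. Including the power [n] keeps the matrix
   nonempty even for [f = 0]. *)
move=> Wf fr Wh; pose n := size f; pose m := (size h + n)%N.
have red (i : 'I_n.+1) : exists g : {poly R}, [/\ g \is a polyOver W, (size g <= n)%N &
    lead_coef f ^+ m * (h.[r] * r ^+ i) = g.[r]].
  have -> : h.[r] * r ^+ i = (h * 'X^i).[r] by rewrite hornerM hornerXn.
  apply: pseudo_reduction => //; first by rewrite rpredM ?polyOverXn.
  rewrite (leq_trans (size_polyMleq _ _)) // size_polyXn addnS /= leq_add2l.
  by rewrite -ltnS.
have {red} [g gP] := choice red.
pose M := \matrix_(i < n.+1, j < n.+1) (g i)`_j.
pose v := \col_(i < n.+1) r ^+ i.
exists m, (char_poly M); split; first exact: char_poly_monic.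
  by apply: char_poly_over => i j; rewrite mxE; case: (gP i) => /polyOverP.
apply: (eigenvector_root_char_poly _ _ _ v); last by rewrite mxE.
apply/colP => i; rewrite !mxE -mulrA; have [_ gn ->] := gP i.
rewrite (horner_coef_wide _ (leqW gn)).
by apply: eq_bigr => j _; rewrite !mxE.
Qed.

(** Multiply an equation of degree [n + 1] for [z / p] by [p ^+ n]: the leading term becomes
    [z ^+ n.+1 / p], and all others lie in [W]. *)
Lemma integral_div (R : comUnitRingType) (W : subringClosed R) (p z : R) (g : {poly R}) :
  p \is a GRing.unit -> p \in W -> z \in W ->
  g \is monic -> g \is a polyOver W -> root g (z / p) ->
  exists k, z ^+ k / p \in W.
Proof.
move=> pU Wp Wz gm /polyOverP Wg /rootP g0.
have : size g = (size g).-1.+1 by rewrite prednK // size_poly_gt0 monic_neq0.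
case: (size g).-1 => [|n] gn.
  move: g0; rewrite (size1_polyC (eq_leq gn)) hornerC => g0.
  move: gm; rewrite monicE lead_coefE gn /= g0 eq_sym oner_eq0 //.
exists n.+1.
have glead : g`_n.+1 = 1 by move: gm; rewrite monicE lead_coefE gn => /eqP.
move: g0; rewrite horner_coef gn big_ord_recr /= glead mul1r.
move=> /(congr1 ( *%R (p ^+ n))); rewrite mulr0 mulrDr.
have pK k : p ^+ k * p^-1 ^+ k = 1 by rewrite -exprMn divrr // expr1n.
have -> : p ^+ n * (z / p) ^+ n.+1 = z ^+ n.+1 / p.
  by rewrite exprMn [p^-1 ^+ n.+1]exprSr mulrCA [p ^+ n * _]mulrA pK mul1r.
move=> /eqP; rewrite addrC addr_eq0 => /eqP ->.
rewrite rpredN mulr_sumr; apply: rpred_sum => i _.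
have -> : p ^+ n * (g`_i * (z / p) ^+ i) = p ^+ (n - i) * (g`_i * z ^+ i).
  have -> : p ^+ n = p ^+ (n - i) * p ^+ i by rewrite -exprD subnK // -ltnS.
  rewrite exprMn -!mulrA; congr (_ * _).
  by rewrite mulrCA; congr (_ * _); rewrite mulrCA pK mulr1.
by rewrite !rpredM ?rpredX.
Qed.

(** * Subrings maximal without the fractions [s / p] *)

(** Used twice: with [S] the complement of [pA] in [A], in place of a localization, and with
    [S = {1}], to conch [1/p]. *)
Lemma conch_exists (R : comUnitRingType) (A S : R -> Prop) (p : R) :
  is_subring A -> (forall s, S s -> ~ A (s / p)) ->
  exists W, [/\ is_subring W, subset_of A W, (forall s, S s -> ~ W (s / p)) &
    forall V, is_subring V -> (forall s, S s -> ~ V (s / p)) -> subset_of W V -> subset_of V W].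
Proof.
move=> hA AS.
have [||||W [[hW WS] AW Wmax]] := @zorn_above (R -> Prop)
  (fun V => is_subring V /\ forall s, S s -> ~ V (s / p)) (@subset_of R) A.
- by move=> V x.
- by move=> U V W UV VW x /UV /VW.
- move=> C C0 CP Ctot; exists (fun x => exists2 V, C V & V x); split; first split.
  + by apply: subring_chain => // V /CP [].
  + by move=> s Ss [V CV Vs]; have [_ VS] := CP _ CV; apply: VS Ss Vs.
  + by move=> V CV x Vx; exists V.
- by split.
exists W; split=> // V hV VS WV; exact: Wmax.
Qed.

(* If [r] is not in [W], then [W[r]] contains some [s / p] with [s] in [S], and
   integrality brings some [z / p], [z] in [S], back into [W]. *)
Lemma conch_integrally_closed (R : comUnitRingType) (W S : R -> Prop) (p : R)
    (hW : is_subring W) :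
  p \is a GRing.unit -> W p -> subset_of S W -> S 1 ->
  (forall x y, S x -> S y -> S (x * y)) ->
  (forall s, S s -> ~ W (s / p)) ->
  (forall V, is_subring V -> (forall s, S s -> ~ V (s / p)) -> subset_of W V -> subset_of V W) ->
  forall (r : R) (f : {poly R}), (forall i, W f`_i) -> S (lead_coef f) -> root f r -> W r.
Proof.
move=> pU Wp SW S1 SM WS Wmax r f Wf Sf fr.
have SX x k : S x -> S (x ^+ k).
  by move=> Sx; elim: k => [|k IHk]; rewrite ?expr0 ?exprS //; apply: SM.
have Wf' : f \is a polyOver (subring_mem R W hW) by apply/polyOverP => i; apply/subring_memP.
apply: (Wmax (adjoin R W hW r)); last exact: mem_adjoin; last exact: sub_adjoin.
  exact: adjoin_subring.
move=> s Ss [h Wh hE].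
have [m [g [gm Wg]]] := adjoin_integral _ _ _ _ _ Wf' fr Wh.
rewrite -hE mulrA => gr.
have Sz : S (lead_coef f ^+ m * s) by apply: SM => //; apply: SX.
have [||k /subring_memP] := integral_div _ _ _ _ _ pU _ _ gm Wg gr.
- exact/subring_memP.
- exact/subring_memP/SW.
by apply: WS; apply: SX.
Qed.

(** * Subrings in which [p] is prime and separated *)

(* As [p] is a unit of [R], divisibility of [x] by [p] in [A] reads [A (x / p)]. *)
Definition separated_prime_subring (R : comUnitRingType) (p : R) (A : R -> Prop) : Prop :=
  [/\ is_subring A, A p, ~ A p^-1,
    (forall a b, A a -> A b -> A (a * b / p) -> A (a / p) \/ A (b / p)) &
    (forall x, (forall n, A (x / p ^+ n)) -> x = 0)].

(** Let [i] and [j] be the first indices at which [p] fails to divide a coefficient of [f] and of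
    [g]. In the coefficient [i + j] of [f * g], [p] divides every other product, hence also the
    product of these two, against primality. *)
Lemma gauss_prime (R : comUnitRingType) (p : R) (A : R -> Prop) (hA : is_subring A) (f g : {poly R}) :
  (forall a b, A a -> A b -> A (a * b / p) -> A (a / p) \/ A (b / p)) ->
  f \is a polyOver (subring_mem R A hA) -> g \is a polyOver (subring_mem R A hA) ->
  p^-1 *: (f * g) \is a polyOver (subring_mem R A hA) ->
  p^-1 *: f \is a polyOver (subring_mem R A hA) \/ p^-1 *: g \is a polyOver (subring_mem R A hA).
Proof.
move=> pprime /polyOverP Af /polyOverP Ag /polyOverP Afg.
have [|nf] := boolP (p^-1 *: f \is a polyOver _); first by left.
have [|ng] := boolP (p^-1 *: g \is a polyOver _); first by right.
have first_bad (q : {poly R}) : p^-1 *: q \isn't a polyOver (subring_mem R A hA) ->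
    exists2 i, ~ A (q`_i / p) & forall j, (j < i)%N -> q`_j / p \in subring_mem R A hA.
  move=> nq; have ex : exists i, q`_i / p \notin subring_mem R A hA.
    apply/not_existsP => allq; case/negP: nq; apply/polyOverP => i.
    by rewrite coefZ mulrC; apply/negPn/negP; apply: allq.
  case: (ex_minnP ex) => i ni imin; exists i; first by move=> /(subring_memP _ _ hA); rewrite (negPf ni).
  by move=> j ji; apply: contraLR ji => /imin; rewrite -leqNgt.
have [i ni fi] := first_bad f nf; have [j nj gj] := first_bad g ng.
suff abp : A (f`_i * g`_j / p).
  by have [||//|//] := pprime _ _ _ _ abp; apply/(subring_memP _ _ hA).
have ij : (i < (i + j).+1)%N by rewrite ltnS leq_addr.
have := Afg (i + j)%N.
rewrite coefZ coefM mulrC (bigD1 (Ordinal ij)) //= addKn mulrDl rpredDr; first by move/subring_memP.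
rewrite mulr_suml; apply: rpred_sum => k; rewrite -val_eqE /= => ki.
have [ltki|leik] := ltnP k i; first by rewrite mulrAC rpredM ?fi.
by rewrite -mulrA rpredM ?gj //; have := ltn_ord k; lia.
Qed.

(** Compatibility with divisibility by [p] is built into the order [le] so that primality and
    separation pass to unions of chains. *)
Lemma maximal_separated_prime_subring (R : comUnitRingType) (p : R) (D : R -> Prop) :
  p \is a GRing.unit -> separated_prime_subring R p D ->
  exists A, [/\ separated_prime_subring R p A, subset_of D A &
    forall A', separated_prime_subring R p A' -> subset_of A A' ->
      (forall x, A x -> A' (x / p) -> A (x / p)) -> subset_of A' A].
Proof.
move=> pU sepD.
pose le (A B : R -> Prop) := subset_of A B /\ forall x, A x -> B (x / p) -> A (x / p).
have [||||A [sepA [DA _] Amax]] := @zorn_above (R -> Prop) (separated_prime_subring R p) le D.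
- by move=> A; split=> // x.
- move=> A B C [AB AB'] [BC BC']; split=> [x /AB /BC //|x Ax Cx].
  by apply: AB' => //; apply: BC' => //; apply: AB.
- move=> C [A0 CA0] Csep Ctot.
  have hU : is_subring (fun x => exists2 A, C A & A x).
    apply: subring_chain; [by exists A0|by move=> A /Csep []|].
    by move=> A B CA CB; have [[]|[]] := Ctot _ _ CA CB; [left|right].
  have compat A x : C A -> A x -> (exists2 B, C B & B (x / p)) -> A (x / p).
    move=> CA Ax [B CB Bx]; have [[_ AB]|[BA _]] := Ctot _ _ CA CB; first exact: AB.
    exact: BA.
  exists (fun x => exists2 A, C A & A x); split; last first.
    by move=> A CA; split=> [x Ax|x Ax]; [exists A|apply: compat].
  split=> //.
  + by exists A0 => //; have [] := Csep _ CA0.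
  + by move=> [A CA Ap]; have [_ _ /(_ Ap)] := Csep _ CA.
  + move=> a b [A CA Aa] [B CB Bb] abp.
    have [E CE [Ea Eb]] : exists2 E, C E & E a /\ E b.
      have [[AB _]|[BA _]] := Ctot _ _ CA CB; first by exists B => //; split=> //; apply: AB.
      by exists A => //; split=> //; apply: BA.
    have [[_ _ EM] _ _ Epr _] := Csep _ CE.
    have [|Eap|Ebp] := Epr a b Ea Eb; first by apply: compat => //; apply: EM.
      by left; exists E.
    by right; exists E.
  (* Compatibility pulls every [x / p ^+ n] back into one member [A] containing [x], and [A] is
     separated. *)
  + move=> x xn; have [A CA Ax] := xn 0%N; have [_ _ _ _] := Csep _ CA; apply.
    elim=> [//|n IHn]; rewrite exprSr invrM ?unitrX // [p^-1 * _]mulrC mulrA.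
    apply: compat => //; rewrite -mulrA [_ * p^-1]mulrC -invrM ?unitrX // -exprSr; exact: xn.
- by [].
- by exists A; split=> // A' sepA' AA' AA'p; have [] := Amax A' sepA' (conj AA' AA'p).
Qed.

(** If [g(t) / p = h(t)], then [g - p h] kills [t], so [p] divides it and hence [g]. Divisibility by
    [p] in [A[t]] can thus be read off coefficients in [A[X]]. *)
Lemma adjoin_separated_prime (R : comUnitRingType) (p t : R) (A : R -> Prop) (hA : is_subring A) :
  p \is a GRing.unit -> separated_prime_subring R p A ->
  (forall f, f \is a polyOver (subring_mem R A hA) -> root f t ->
     p^-1 *: f \is a polyOver (subring_mem R A hA)) ->
  separated_prime_subring R p (adjoin R A hA t) /\
  (forall x, A x -> adjoin R A hA t (x / p) -> A (x / p)).
Proof.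
move=> pU [_ Ap Ap' Apr Asep] Anull.
have div_coef g : g \is a polyOver (subring_mem R A hA) -> adjoin R A hA t (g.[t] / p) ->
    p^-1 *: g \is a polyOver (subring_mem R A hA).
  move=> Ag [h Ah hE]; have Aph : p *: h \is a polyOver (subring_mem R A hA).
    by rewrite polyOverZ //; apply/subring_memP.
  have := Anull (g - p *: h); rewrite rpredB // => /(_ isT).
  rewrite scalerBr scalerA mulVr // scale1r rpredBr //; apply.
  by apply/rootP; rewrite hornerD hornerN hornerZ -hE mulrC divrK // subrr.
have compat x : A x -> adjoin R A hA t (x / p) -> A (x / p).
  move=> Ax; have {1}-> : x = (x%:P).[t] by rewrite hornerC.
  have Ax' : x%:P \is a polyOver (subring_mem R A hA) by rewrite polyOverC; apply/subring_memP.
  move=> /(div_coef _ Ax') /polyOverP/(_ 0%N); rewrite coefZ coefC mulrC.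
  by move/subring_memP.
have [A1 _ _] := hA.
split=> //; split.
- exact: adjoin_subring.
- exact: sub_adjoin.
- by rewrite -[p^-1]mul1r => /(compat _ A1); rewrite mul1r.
- move=> _ _ [f Af ->] [g Ag ->]; rewrite -hornerM => /(div_coef _ (rpredM Af Ag)).
  case/(gauss_prime _ _ _ _ _ _ Apr Af Ag) => Ah; [left|right];
    by eexists; [exact: Ah|rewrite hornerZ mulrC].
- move=> x xn; have [g Ag] := xn 0%N; rewrite divr1 => xE.
  (* A single [g] representing [x] is divisible by every power of [p], so separation of [A] kills
     its coefficients. *)
  suff gn n : (p ^- n) *: g \is a polyOver (subring_mem R A hA).
    rewrite xE (_ : g = 0) ?horner0 //; apply/polyP => i; rewrite coef0.
    apply: Asep => n; have /polyOverP/(_ i) := gn n; rewrite coefZ mulrC.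
    by move/subring_memP.
  elim: n => [|n IHn]; first by rewrite invr1 scale1r.
  rewrite exprSr invrM ?unitrX // -scalerA; apply: div_coef => //.
  rewrite hornerZ -xE (_ : _ / p = x / p ^+ n.+1) //.
  by rewrite exprS invrM ?unitrX // mulrA [x * _]mulrC.
Qed.

(** Otherwise [A[t]] is an admissible enlargement, so [t] lies in [A] by maximality; but then
    ['X - t] kills [t], and its leading coefficient 1 is not divisible by [p]. *)
Lemma root_of_nonmultiple (R : comUnitRingType) (p : R) (A : R -> Prop) (hA : is_subring A) :
  p \is a GRing.unit -> separated_prime_subring R p A ->
  (forall A', separated_prime_subring R p A' -> subset_of A A' ->
      (forall x, A x -> A' (x / p) -> A (x / p)) -> subset_of A' A) ->
  forall t, exists f, [/\ f \is a polyOver (subring_mem R A hA), root f t &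
    p^-1 *: f \isn't a polyOver (subring_mem R A hA)].
Proof.
move=> pU sepA Amax t; apply: contrapT => /forallNP noroot.
have Anull f : f \is a polyOver (subring_mem R A hA) -> root f t ->
    p^-1 *: f \is a polyOver (subring_mem R A hA).
  by move=> Af ft; apply/negPn/negP => nf; apply: (noroot f).
have [sepAt compat] := adjoin_separated_prime _ _ _ _ _ pU sepA Anull.
have At := Amax _ sepAt (sub_adjoin _ _ _ _) compat _ (mem_adjoin _ _ _ _).
have /Anull : 'X - t%:P \is a polyOver (subring_mem R A hA).
  by rewrite rpredB ?polyOverX ?polyOverC //; apply/subring_memP.
rewrite root_XsubC eqxx => /(_ isT)/polyOverP/(_ 1%N).
rewrite coefZ coefB coefX coefC /= subr0 mulr1 => /subring_memP.
by case: sepA.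
Qed.

(** Write the leading coefficient of [f], of degree [n], as [p^k u] with [k] maximal. Then
    [p^(k(n-1)) f(X / p^k)] has coefficients in [A], leading coefficient [u] and root [p^k t]. *)
Lemma rescaled_root (R : comUnitRingType) (p t : R) (A : R -> Prop) (hA : is_subring A) (f : {poly R}) :
  p \is a GRing.unit -> separated_prime_subring R p A ->
  f \is a polyOver (subring_mem R A hA) -> root f t -> f != 0 ->
  exists k, exists g, [/\ g \is a polyOver (subring_mem R A hA), root g (p ^+ k * t) &
    ~ A (lead_coef g / p)].
Proof.
move=> pU [_ Ap Ap' Apr Asep] Af /rootP ft f0.
have Ap1 : p \in subring_mem R A hA by apply/subring_memP.
have ex : exists n, lead_coef f / p ^+ n \notin subring_mem R A hA.
  apply/not_existsP => allA; case/negP: f0; rewrite -lead_coef_eq0; apply/eqP/Asep => n.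
  by apply/(subring_memP _ _ hA)/negPn/negP/allA.
case: (ex_minnP ex) => -[|k] nk kmin.
  by case/negP: nk; rewrite divr1; apply: (polyOverP Af).
have uA : lead_coef f / p ^+ k \in subring_mem R A hA.
  by apply/negPn/negP => /kmin; rewrite ltnn.
have fn : size f = (size f).-1.+1 by rewrite prednK // size_poly_gt0.
set n := (size f).-1 in fn.
pose c i := if i == n then lead_coef f / p ^+ k else f`_i * p ^+ (k * (n - i).-1).
pose g := \poly_(i < n.+1) c i.
(* The extra factor [p ^+ k] avoids the exponent [n - 1], which would be truncated for constant
   [f]. *)
have cE i : (i <= n)%N -> p ^+ k * (c i * (p ^+ k * t) ^+ i) = p ^+ (k * n) * (f`_i * t ^+ i).
  rewrite /c leq_eqVlt => /orP[/eqP->|ltin].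
    rewrite eqxx lead_coefE -/n exprMn -exprM mulrA [p ^+ k * _]mulrC.
    by rewrite divrK ?unitrX // mulrCA.
  rewrite ltn_eqF // exprMn -exprM (_ : (k * n = k + (k * (n - i).-1 + k * i))%N); last first.
    by rewrite -mulnDr -mulnS; congr (_ * _)%N; lia.
  rewrite !exprD -!mulrA; congr (_ * _); rewrite mulrCA; congr (_ * _); exact: mulrCA.
have gl : lead_coef g = lead_coef f / p ^+ k.
  rewrite lead_coef_poly ?/c ?eqxx //.
  apply/eqP => u0; case/negP: nk; rewrite exprSr invrM ?unitrX // mulrCA u0 mulr0.
  exact: rpred0.
exists k, g; split.
- apply/polyOverP => i; rewrite coef_poly; case: ifP => _; last exact: rpred0.
  by rewrite /c; case: eqP => // _; rewrite rpredM ?rpredX //; apply: (polyOverP Af).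
- apply/rootP/(mulrI (unitrX k pU)); rewrite mulr0 horner_poly mulr_sumr.
  under eq_bigr => i _ do rewrite cE ?leq_ord //.
  by rewrite -mulr_sumr -[n.+1]fn -horner_coef ft mulr0.
- rewrite gl -mulrA -invrM ?unitrX // -exprS => /(subring_memP _ _ hA).
  by rewrite (negPf nk).
Qed.

(** * From the prime element of [D] to the maximal subring *)

Lemma dvd_inE (R : comUnitRingType) (D : R -> Prop) (a x : R) :
  a \is a GRing.unit -> dvd_in D a x <-> D (x / a).
Proof.
move=> aU; split=> [[c [Dc ->]]|Dx]; first by rewrite mulrC mulKr.
by exists (x / a); split; rewrite // mulrCA divrr ?mulr1.
Qed.

Lemma prime_elt_separated (R : comUnitRingType) (D : R -> Prop) (p : R) :
  is_subring D -> prime_elt_in D p ->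
  (forall x, D x -> (forall n : nat, (0 < n)%N -> dvd_in D (p ^+ n) x) -> x = 0) ->
  p \is a GRing.unit -> separated_prime_subring R p D.
Proof.
move=> hD [Dp _ pN pM] Dsep pU; split=> //.
- by move=> Dp'; apply: pN; exists p^-1; rewrite divrr.
- by move=> a b Da Db /(dvd_inE _ _ _ _ pU)/(pM _ _ Da Db) [] /(dvd_inE _ _ _ _ pU); [left|right].
- move=> x Dx; apply: Dsep => [|n _]; first by have := Dx 0%N; rewrite divr1.
  by apply/dvd_inE; rewrite ?unitrX.
Qed.

(** The last clause expresses [W[1/p] = R]: a subring containing [W] and [1/p] is all of [R]. *)
Lemma exists_p_generating_subring (R : comUnitRingType) (D : R -> Prop) (p : R) :
  p \is a GRing.unit -> separated_prime_subring R p D ->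
  exists W, [/\ is_subring W, subset_of D W, ~ W p^-1 & forall t, exists k, W (p ^+ k * t)].
Proof.
move=> pU sepD.
have [A [sepA DA Amax]] := maximal_separated_prime_subring _ _ _ pU sepD.
have [hA Ap Ap' Apr _] := sepA.
have [A1 _ AM] := hA.
(* This set is multiplicative because [p] is prime in [A], and contains 1 because [1/p] is not in
   [A]. *)
pose S s := A s /\ ~ A (s / p).
have S1 : S 1 by split=> //; rewrite mul1r.
have [|W [hW AW WS Wmax]] := conch_exists R A S p hA; first by move=> s [].
exists W; split=> //; [by move=> x /DA /AW|by rewrite -[p^-1]mul1r; apply: WS|move=> t].
have [f [Af ft nf]] := root_of_nonmultiple _ _ _ hA pU sepA Amax t.
have f0 : f != 0 by apply: contraNneq nf => ->; rewrite scaler0 rpred0.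
have [k [g [/polyOverP Ag gt ng]]] := rescaled_root _ _ _ _ _ _ pU sepA Af ft f0.
have {}Ag i : A g`_i by apply/subring_memP.
exists k; apply: (conch_integrally_closed _ W S p _ _ _ _ S1 _ WS Wmax _ g) => //.
- exact: AW.
- by move=> s [/AW].
- move=> a b [Aa na] [Ab nb]; split; first exact: AM.
  by move=> /(Apr _ _ Aa Ab) [].
- by move=> i; apply: AW.
- by split=> //; apply: Ag.
Qed.

Theorem theorem2p1 (R : comUnitRingType) (D : R -> Prop) (p : R) :
  is_domain_subring D ->
  prime_elt_in D p ->
  (forall x, D x -> (forall n : nat, (0 < n)%N -> dvd_in D (p ^+ n) x) -> x = 0) ->
  p \is a GRing.unit ->
  exists W : R -> Prop,
    [/\ maximal_subring W, integrally_closed_in W, subset_of D W & conches W p^-1].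
Proof.
move=> [hD _] pprime Dsep pU.
have sepD := prime_elt_separated _ _ _ hD pprime Dsep pU.
have [W [hW DW Wp' Wgen]] := exists_p_generating_subring _ _ _ pU sepD.
(* With [eq 1] as the set [{1}], [V] is maximal among the subrings above [W] that avoid [1/p]. *)
have [|V [hV WV VS Vmax]] := conch_exists R W (eq 1) p hW.
  by move=> _ <-; rewrite mul1r.
have avoid U : ~ U p^-1 -> forall s, 1 = s -> ~ U (s / p) by move=> Up _ <-; rewrite mul1r.
have Vp' : ~ V p^-1 by rewrite -[p^-1]mul1r; apply: VS.
have DV : subset_of D V by move=> x /DW /WV.
have Vp : V p by apply: DV; case: pprime.
exists V; split=> //.
- split=> //; first by exists p^-1.
  (* If [T] contained [1/p], it would contain [x = p^-k (p^k x)], yet [x] is outside [T]. So [T]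
     avoids [1/p] and maximality of [V] applies. *)
  move=> T hT VT [x Tx]; apply: Vmax => //; apply: avoid => Tp'; apply: Tx.
  have [k Wk] := Wgen x; have [_ _ TM] := hT; have [T1 _ _] := hT.
  have TpX : T (p ^- k).
    by rewrite -exprVn; elim: k {Wk} => [|k IHk]; rewrite ?expr0 // exprS; apply: TM.
  by rewrite -(mulKr (unitrX k pU) x); apply: TM => //; apply/VT/WV.
- move=> r [f [fm Vf fr]].
  apply: (conch_integrally_closed _ V (eq 1) p hV pU Vp _ erefl _ VS Vmax r f) => //.
  + by move=> _ <-; case: hV.
  + by move=> _ _ <- <-; rewrite mul1r.
  + by rewrite (monicP fm).
- split=> //; first by rewrite invrK.
  by move=> T hT VT _ Tp'; apply: Vmax => //; apply: avoid.
Qed.
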